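(* Let $f:\mathbb{R}^d\to\mathbb{R}$ be a differentiable (not necessarily convex) $L$-smooth function and let $f^*$ be a real number with $-\infty<f^*\le\inf_{x\in\mathbb{R}^d}f(x)$. Suppose $f$ is accessed through a stochastic first-order oracle that is unbiased and has noise with $p$-th moment bounded by $\sigma^p$, for some $\sigma>0$ and $p\in(1,2]$. Let $T\ge1$ be an integer, let $\delta\in(0,1)$, let $x_1\in\mathbb{R}^d$ be the initial point, and let $\Delta_1=f(x_1)-f^*>0$. Run Clipped-SGD for $T$ iterations from $x_1$ with the constant parameters $$\lambda_t=\lambda=\max\left\{\left(\frac{8\ln\frac{4T}{\delta}}{\sqrt{L\Delta_1}}\right)^{\frac1{p-1}}T^{\frac1{3p-2}}\sigma^{\frac p{p-1}},\ 4\sqrt{L\Delta_1},\ 32^{1/p}\sigma T^{\frac1{3p-2}}\right\},$$ $$\eta_t=\eta=\frac{\sqrt{\Delta_1}\,T^{\frac{1-p}{3p-2}}}{8\lambda\sqrt L\ln\frac{4T}{\delta}}=\frac{\sqrt{\Delta_1}}{8\sqrt L\ln\frac{4T}{\delta}}\min\left\{\left(\frac{8\ln\frac{4T}{\delta}}{\sqrt{L\Delta_1}}\right)^{\frac{-1}{p-1}}T^{\frac{-p}{3p-2}}\sigma^{\frac{-p}{p-1}},\ \frac{T^{\frac{1-p}{3p-2}}}{4\sqrt{L\Delta_1}},\ \frac{T^{\frac{-p}{3p-2}}}{32^{1/p}\sigma}\right\}.$$ Then, with probability at least $1-\delta$, the iterate sequence $(x_t)_{t\ge1}$ satisfies $$\frac1T\sum_{t=1}^T\|\nabla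 f(x_t)\|^2\le 32\sqrt{\Delta_1L}\,\ln\frac{4T}{\delta}\,\max\left\{\left(\frac{8\ln\frac{4T}{\delta}}{\sqrt{L\Delta_1}}\right)^{\frac1{p-1}}T^{\frac{2-2p}{3p-2}}\sigma^{\frac p{p-1}},\ 4\sqrt{L\Delta_1}\,T^{\frac{1-2p}{3p-2}},\ 32^{1/p}\sigma T^{\frac{2-2p}{3p-2}}\right\}.$$
   Context: $\|\cdot\|$ is the Euclidean norm. $f$ is $L$-smooth ($L>0$) if $\|\nabla f(x)-\nabla f(y)\|\le L\|x-y\|$ for all $x,y\in\mathbb{R}^d$. Stochastic oracle: when queried at $x$, it returns a history-independent random vector $\widehat{\nabla} f(x)$ such that, conditioned on the history and the queried point $x$, $\mathbb{E}[\widehat{\nabla} f(x)\mid x]=\nabla f(x)$ (unbiasedness) and $\mathbb{E}[\|\widehat{\nabla} f(x)-\nabla f(x)\|^p\mid x]\le\sigma^p$ (bounded $p$-th moment noise). Clipped-SGD with (deterministic) initial point $x_1$, step sizes $\{\eta_t\}$ and clipping parameters $\{\lambda_t\}$: for $t=1,\dots,T$, query the oracle at $x_t$ to obtain $\widehat{\nabla} f(x_t)$, set $$\widetilde{\nabla} f(x_t)=\min\left\{1,\frac{\lambda_t}{\|\widehat{\nabla} f(x_t)\|}\right\}\widehat{\nabla} f(x_t)$$ (equal to $0$ if $\widehat{\nabla} f(x_t)=0$), and $x_{t+1}=x_t-\eta_t\widetilde{\nabla} f(x_t)$. *)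

(* Defs.v *)
From HB Require Import structures.
From mathcomp Require Import all_boot all_order all_algebra.
From mathcomp Require Import all_classical all_reals all_analysis.

Set Implicit Arguments.
Unset Strict Implicit.
Unset Printing Implicit Defensive.

Import Order.TTheory GRing.Theory Num.Theory.
Import numFieldNormedType.Exports.

Local Open Scope classical_set_scope.
Local Open Scope ring_scope.

(* R^n is 'rV[R]_n, with the sigma-algebra generated by the coordinates; as
   n is finite, this is the Borel sigma-algebra. The construction follows that
   of n.-tuple T in the library. *)
Definition measure_rV_display : measure_display.
Proof. exact: default_measure_display. Qed.

Section measurable_rV.
Variables (R : realType) (n : nat).

Let coors : 'I_n -> 'rV[R]_n -> R := fun i v => v ord0 i.

Let rV_set0 : g_sigma_preimage coors set0.
Proof. exact: sigma_algebra0. Qed.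

Let rV_setC A : g_sigma_preimage coors A -> g_sigma_preimage coors (~` A).
Proof. exact: sigma_algebraC. Qed.

Let rV_bigcup (F : _^nat) : (forall i, g_sigma_preimage coors (F i)) ->
  g_sigma_preimage coors (\bigcup_i (F i)).
Proof. exact: sigma_algebra_bigcup. Qed.

HB.instance Definition _ := @isMeasurable.Build
  measure_rV_display 'rV[R]_n (g_sigma_preimage coors)
  rV_set0 rV_setC rV_bigcup.

End measurable_rV.

(* The library's norm `|v| on 'rV[R]_n is the sup norm; the two induce the same
   topology, so that differentiability is not affected. *)
Definition enorm (R : realType) (n : nat) (v : 'rV[R]_n) : R :=
  Num.sqrt (\sum_i v ord0 i ^+ 2).

Definition gradient (R : realType) (n : nat) (f : 'rV[R]_n -> R)
    (x : 'rV[R]_n) : 'rV[R]_n :=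
  \row_i 'D_(delta_mx ord0 i) f x.

Definition smooth (R : realType) (n : nat) (L : R) (f : 'rV[R]_n -> R) : Prop :=
  forall x y, enorm (gradient f x - gradient f y) <= L * enorm (x - y).

(* A stochastic first-order oracle is a probability kernel: oracle x is the law
   of the answer to a query at x. That the answer to a query depends on the past
   only through x is the field [sgd_query] of [clipped_sgd] below. *)
Definition unbiased (R : realType) (n : nat) (f : 'rV[R]_n -> R)
    (oracle : R.-pker 'rV[R]_n ~> 'rV[R]_n) : Prop :=
  forall x, forall i : 'I_n,
    (\int[oracle x]_y (y ord0 i)%:E = (gradient f x ord0 i)%:E)%E.

Definition bounded_noise (R : realType) (n : nat) (f : 'rV[R]_n -> R)
    (oracle : R.-pker 'rV[R]_n ~> 'rV[R]_n) (p sigma : R) : Prop :=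
  forall x,
    (\int[oracle x]_y (enorm (y - gradient f x) `^ p)%:E <= (sigma `^ p)%:E)%E.

(* 0^-1 = 0, but in any case clip lambda 0 = 0. *)
Definition clip (R : realType) (n : nat) (lambda : R)
    (g : 'rV[R]_n) : 'rV[R]_n :=
  Num.min 1 (lambda / enorm g) *: g.

(* The sigma-algebra generated by the answers g 1, ..., g t.-1. *)
Definition history (R : realType) (n : nat) (Omega : Type)
    (g : nat -> Omega -> 'rV[R]_n) (t : nat) : set (set Omega) :=
  <<s \bigcup_(s in [set s | (1 <= s < t)%N])
        preimage_set_system setT (g s) measurable >>.

(* g t is the answer of the oracle to the query at the iterate x t. The field
   [sgd_query] says that, given the history, g t has conditional law
   oracle (x t). Since x 1, ..., x t are functions of g 1, ..., g t.-1, the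
   history need not mention them. *)
Record clipped_sgd (R : realType) (n : nat) (disp : measure_display)
    (Omega : measurableType disp) (P : probability Omega R)
    (oracle : R.-pker 'rV[R]_n ~> 'rV[R]_n) (T : nat) (x1 : 'rV[R]_n)
    (eta lambda : nat -> R) (x g : nat -> Omega -> 'rV[R]_n) : Prop := {
  sgd_measurable : forall t, (1 <= t <= T)%N -> measurable_fun setT (g t) ;
  sgd_init : forall w, x 1 w = x1 ;
  sgd_query : forall t, (1 <= t <= T)%N ->
    forall (A : set Omega) (B : set 'rV[R]_n), history g t A -> measurable B ->
    (P (A `&` g t @^-1` B) = \int[P]_(w in A) oracle (x t w) B)%E ;
  sgd_step : forall t, (1 <= t <= T)%N ->
    forall w, x t.+1 w = x t w - eta t *: clip (lambda t) (g t w) }.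

(* Main.v *)
(* Write G_t for the gradient at x_t, A for ln (4T/delta), and let
     Q_t = f(x_t) - f^* + eta/2 * sum_(s < t) |G_s|^2,
   so that Q_1 = Delta1 and the claim is implied by Q_(T+1) <= 2 Delta1. As
   long as Q_t <= 2 Delta1, smoothness gives |G_t| <= 2 sqrt(L Delta1) <=
   lambda/2, and then the error theta = clip(g_t) - G_t satisfies pointwise
   bounds in terms of nu = (|g_t - G_t| / lambda)^p: |theta| <= 3 lambda/2,
   |theta|^2 <= 9 lambda^2 nu and |clip(g_t) - g_t| <= 2 lambda nu. Together
   with the descent lemma and e^u <= 1 + u + 2u^2 for u <= 1, they bound
   exp(kappa (Q_(t+1) - Q_t)), with kappa = 2A / Delta1, by an affine function
   of nu plus a multiple of <G_t, g_t - G_t>, which has mean zero. Hence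
   exp(kappa Q_t), stopped when Q_t exceeds 2 Delta1, is multiplied in mean by
   at most exp(rho) at each step, where T rho <= A by the choice of lambda and
   eta. Markov's inequality bounds the probability that Q ever exceeds 2
   Delta1 by exp(A + kappa Delta1 - 2 kappa Delta1) = exp(-A) <= delta. *)
Require Import Defs.
From HB Require Import structures.
From mathcomp Require Import all_boot all_order all_algebra.
From mathcomp Require Import all_classical all_reals all_analysis.
From mathcomp Require Import measurable_realfun giry.
From mathcomp Require Import ring lra.

Set Implicit Arguments.
Unset Strict Implicit.
Unset Printing Implicit Defensive.

Import Order.TTheory GRing.Theory Num.Theory.
Import numFieldNormedType.Exports.

Local Open Scope classical_set_scope.
Local Open Scope ring_scope.

(** * Disintegration along a kernel *)

Section kernel_giry.
Context d1 d2 (X : measurableType d1) (Y : measurableType d2) (R : realType).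
Variable k : R.-spker X ~> Y.

(** A copy of [k x] under its own head symbol, to which the sub-probability structure required by
    [giry] can be attached. *)
Definition kernel_measure (x : X) : set Y -> \bar R := k x.

HB.instance Definition _ x := Measure.on (kernel_measure x).

HB.instance Definition _ x :=
  Measure_isSubProbability.Build _ Y R (kernel_measure x)
    (sprob_kernel_le1 k x).

Let kernel_giry (x : X) : giry Y R := kernel_measure x.

(** The product of the Dirac mass at [x] with [k x]. *)
Let pair_law (x : X) : giry (X * Y)%type R :=
  giry_map (pair1_measurable x) (kernel_giry x).

Let measurable_pair_law : measurable_fun [set: X] pair_law.
Proof.
apply: measurable_giry_codensity => // B mB.
rewrite (_ : (fun x => _) = (fun x => k x (xsection B x))); last first.
  by apply/funext => x; rewrite xsectionE.
exact: measurable_fun_xsection_finite_kernel (mem_set mB).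
Qed.

(** Both sides integrate [phi] against a measure on the product: the joint law [m1] of [h] and [g],
    and the mixture [m2] of the laws [pair_law (h w)]. These agree on measurable rectangles, a
    pi-system that generates the product sigma-algebra. *)
Lemma disintegration d (Omega : measurableType d) (P : probability Omega R)
    (h : Omega -> X) (g : Omega -> Y) :
  measurable_fun setT h -> measurable_fun setT g ->
  (forall A B, measurable A -> measurable B ->
    P (h @^-1` A `&` g @^-1` B) = \int[P]_(w in h @^-1` A) k (h w) B)%E ->
  forall phi : X * Y -> \bar R, measurable_fun [set: X * Y] phi ->
    (forall z, 0 <= phi z)%E ->
  (\int[P]_w phi (h w, g w) = \int[P]_w \int[k (h w)]_y phi (h w, y))%E.
Proof.
move=> mh mg Phg phi mphi phi0.
have mhg : measurable_fun setT (fun w => (h w, g w)).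
  exact: measurable_fun_pair.
have mlaw : measurable_fun setT (pair_law \o h).
  exact: measurableT_comp measurable_pair_law mh.
pose m1 : giry (X * Y)%type R := giry_map mhg (P : giry Omega R).
pose m2 : giry (X * Y)%type R := giry_bind (P : giry Omega R) mlaw.
have -> : (\int[P]_w phi (h w, g w) = \int[m1]_z phi z)%E.
  by rewrite -[RHS]/(giry_int m1 phi) giry_int_map.
have -> : (\int[P]_w \int[k (h w)]_y phi (h w, y) = \int[m2]_z phi z)%E.
  rewrite -[RHS]/(giry_int m2 phi) giry_int_bind//.
  apply: eq_integral => w _; rewrite /= giry_int_map//.
apply: eq_measure_integral => C mC _.
have rectI : setI_closed
    [set A `*` B | A in @measurable _ X & B in @measurable _ Y].
  move=> _ _ [A mA] [B mB] <- [A' mA'] [B' mB'] <-.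
  exists (A `&` A'); first exact: measurableI.
  exists (B `&` B'); first exact: measurableI.
  by rewrite setXI.
apply: (measure_unique _ (fun=> setT)
  (measurable_prod_measurableType X Y) rectI) => //.
- by move=> _; exists setT => //; exists setT => //; rewrite setXTT.
- by rewrite bigcup_const//; exists 0%N.
- move=> _ [A mA] [B mB] <-.
  have mAB : measurable (A `*` B) by exact: measurableX.
  rewrite [LHS](_ : _ = P (h @^-1` A `&` g @^-1` B)) // Phg //.
  rewrite [RHS](_ : _ = giry_int (giry_map mlaw (P : giry Omega R))
    (giry_ev ^~ (A `*` B)))//.
  rewrite giry_int_map//; last exact: measurable_giry_ev.
  rewrite integral_mkcond; apply: eq_integral => w _; rewrite patchE.
  rewrite /giry_ev /pair_law /giry_map /= /pushforward /kernel_measure.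
  (* The law of the pair gives the rectangle mass [k (h w) B] if [h w] lies in [A], and mass 0
     otherwise. *)
  case: ifPn; rewrite ?inE ?notin_setE /= => Ahw.
    by congr (k _ _); apply/seteqP; split => y //= [].
  by rewrite (_ : _ @^-1` _ = set0) ?measure0//; apply/seteqP; split => y // [].
- by move=> _; apply: le_lt_trans (ltry 1); exact: sprobability_setT.
Qed.
End kernel_giry.
(** * Measurability and Euclidean geometry in R^n *)

Section measurable_rV_theory.
Context (R : realType) (n : nat).
Implicit Types (f : 'rV[R]_n -> R).

Lemma measurable_coord (i : 'I_n) :
  measurable_fun [set: 'rV[R]_n] (fun v => v ord0 i).
Proof.
move=> _ B mB; rewrite setTI; apply: sub_sigma_algebra => /=.
rewrite -bigcup_seq/=; exists i => /=; first by rewrite mem_index_enum.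
by exists B => //; rewrite setTI.
Qed.

Lemma measurable_fun_rV d (T : measurableType d) (h : T -> 'rV[R]_n) :
  (forall i, measurable_fun setT (fun t => h t ord0 i)) ->
  measurable_fun setT h.
Proof.
move=> mh; apply: (measurability
  (\big[setU/set0]_(i < n) preimage_set_system setT
     (fun v : 'rV[R]_n => v ord0 i) measurable)) => //.
move=> _ [A + <-]; rewrite -bigcup_seq/= => -[i _ [B mB <-]].
by rewrite !setTI -[X in measurable X]setTI; exact: mh.
Qed.

(** Cubes with rational centre and radius 1/(m+1): a countable base of the topology, so that every
    open set is a countable union of them. *)
Let box (q : 'rV[rat]_n) (m : nat) : set 'rV[R]_n :=
  [set v | forall i, `|ratr (q ord0 i) - v ord0 i| < m.+1%:R^-1].

Let measurable_box q m : measurable (box q m).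
Proof.
have -> : box q m = \big[setI/setT]_(i < n)
    [set v : 'rV[R]_n | `|ratr (q ord0 i) - v ord0 i| < m.+1%:R^-1].
  rewrite -bigcap_seq; apply/seteqP; split=> v /= hv i //=.
  by apply: (hv i); rewrite /= mem_index_enum.
elim/big_ind: _ => [||i _]; [exact: measurableT|exact: measurableI|].
have mi : measurable_fun setT
    (fun v : 'rV[R]_n => `|ratr (q ord0 i) - v ord0 i|).
  apply: measurableT_comp; first exact: normr_measurable.
  by apply: measurable_funB => //; exact: measurable_coord.
have := mi measurableT _ (measurable_itv `]-oo, (m.+1%:R^-1 : R)[).
by rewrite setTI; congr measurable; apply/seteqP; split=> v /=; rewrite in_itv.
Qed.

Lemma open_measurable_rV (U : set 'rV[R]_n) : open U -> measurable U.
Proof.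
move=> oU.
pose F (qm : 'rV[rat]_n * nat) := if `[< box qm.1 qm.2 `<=` U >] then
  box qm.1 qm.2 else set0.
rewrite (_ : U = \bigcup_qm F qm).
  apply: countable_bigcupT_measurable => // -[q m]; rewrite /F.
  by case: asboolP => // _; exact: measurable_box.
apply/seteqP; split=> [v Uv|v [[q m] _]]; last first.
  by rewrite /F; case: asboolP => //= qU; exact: qU.
have /nbhs_ballP[e /= e0 eU] : nbhs v U by exact: open_nbhs_nbhs.
(* Two points of one cube differ by less than 2/(m+1) in each coordinate, hence e/2. *)
have [m me] : exists m, m.+1%:R^-1 < e / 2.
  have /ltr_add_invr[m me] : 0 < e / 2 by rewrite divr_gt0.
  by exists m; rewrite -(add0r _^-1).
have hq i : exists q : rat, `|ratr q - v ord0 i| < m.+1%:R^-1.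
  have [q] : exists q : rat, v ord0 i < ratr q < v ord0 i + m.+1%:R^-1.
    have /rat_in_itvoo[q] : v ord0 i < v ord0 i + m.+1%:R^-1.
      by rewrite ltrDl invr_gt0.
    by rewrite in_itv /=; exists q.
  by move=> /andP[? ?]; exists q; rewrite gtr0_norm ?subr_gt0// ltrBlDl.
have [q hqv] := choice hq.
exists (\row_i q i, m) => //; rewrite /F /=.
have vq : box (\row_i q i) m v by move=> i; rewrite mxE.
case: asboolP => // -[] w hw.
apply: eU; split => // i j; rewrite ord1 /ball /=.
have := hw j; have := vq j; rewrite mxE => h1 h2.
rewrite (_ : v ord0 j - w ord0 j =
  (ratr (q j) - w ord0 j) - (ratr (q j) - v ord0 j)); last by ring.
apply: (le_lt_trans (ler_normB _ _)); move: me h1 h2.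
by set c := m.+1%:R^-1; lra.
Qed.

Lemma continuous_measurable_rV f : continuous f -> measurable_fun setT f.
Proof.
move=> cf.
apply: (measurability _ (RGenOpens.measurableE R)) => _ [_ [a [b ->]] <-].
rewrite setTI; apply: open_measurable_rV; exact: open_comp.
Qed.

End measurable_rV_theory.

(** * The inner product, the Euclidean norm and clipping *)

Section euclidean.
Context (R : realType) (n : nat).
Implicit Types (u v w : 'rV[R]_n).

Definition dot u v : R := \sum_i u ord0 i * v ord0 i.

Lemma dotC u v : dot u v = dot v u.
Proof. by apply: eq_bigr => i _; rewrite mulrC. Qed.

Lemma dotDr u v w : dot u (v + w) = dot u v + dot u w.
Proof. by rewrite -big_split; apply: eq_bigr => i _; rewrite mxE mulrDr. Qed.

Lemma dotZr a u v : dot u (a *: v) = a * dot u v.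
Proof. by rewrite mulr_sumr; apply: eq_bigr => i _; rewrite mxE mulrCA. Qed.

Lemma dotNr u v : dot u (- v) = - dot u v.
Proof. by rewrite -scaleN1r dotZr mulN1r. Qed.

Lemma dotBr u v w : dot u (v - w) = dot u v - dot u w.
Proof. by rewrite dotDr dotNr. Qed.

Lemma enorm_ge0 u : 0 <= enorm u.
Proof. exact: sqrtr_ge0. Qed.

Lemma sqr_enorm u : enorm u ^+ 2 = dot u u.
Proof. by rewrite sqr_sqrtr//; apply: sumr_ge0 => i _; rewrite sqr_ge0. Qed.

Lemma enormZ a u : enorm (a *: u) = `|a| * enorm u.
Proof.
rewrite /enorm -sqrtr_sqr -sqrtrM ?sqr_ge0//; congr Num.sqrt.
by rewrite mulr_sumr; apply: eq_bigr => i _; rewrite mxE exprMn.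
Qed.

Lemma enormN u : enorm (- u) = enorm u.
Proof. by rewrite -scaleN1r enormZ normrN1 mul1r. Qed.

Lemma enorm0 : enorm (0 : 'rV[R]_n) = 0.
Proof. by rewrite -(scale0r 0) enormZ normr0 mul0r. Qed.

Lemma sqr_enormD u v :
  enorm (u + v) ^+ 2 = enorm u ^+ 2 + 2 * dot u v + enorm v ^+ 2.
Proof.
rewrite !sqr_enorm dotDr (dotC _ u) (dotC _ v) !dotDr (dotC v u); ring.
Qed.

Lemma coord_le_enorm u i : `|u ord0 i| <= enorm u.
Proof.
rewrite -sqrtr_sqr ler_sqrt ?sumr_ge0//; last by move=> *; rewrite sqr_ge0.
by rewrite (bigD1 i)//= lerDl sumr_ge0// => j _; rewrite sqr_ge0.
Qed.

Lemma enorm_eq0 u : enorm u = 0 -> u = 0.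
Proof.
move=> u0; apply/rowP => i; rewrite mxE; apply/eqP.
by rewrite -normr_le0 -u0 coord_le_enorm.
Qed.

(** Cauchy-Schwarz: expand the squared norm of |v| u - |u| v and divide by 2 |u| |v|. *)
Lemma dot_le_enorm u v : dot u v <= enorm u * enorm v.
Proof.
have dot0r w : dot w 0 = 0 by rewrite -(scale0r 0) dotZr mul0r.
have [/enorm_eq0 ->|u0] := eqVneq (enorm u) 0.
  by rewrite dotC dot0r enorm0 mul0r.
have [/enorm_eq0 ->|v0] := eqVneq (enorm v) 0.
  by rewrite dot0r enorm0 mulr0.
have up : 0 < enorm u by rewrite lt_def u0 enorm_ge0.
have vp : 0 < enorm v by rewrite lt_def v0 enorm_ge0.
have := sqr_ge0 (enorm (enorm v *: u + (- enorm u) *: v)).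
rewrite sqr_enormD !enormZ normrN !ger0_norm ?enorm_ge0// dotZr dotC dotZr dotC.
rewrite (_ : _ + _ = 2 * (enorm u * enorm v) *
  (enorm u * enorm v - dot u v)); last by ring.
by rewrite pmulr_rge0 ?subr_ge0// !mulr_gt0.
Qed.

Lemma norm_dot_le u v : `|dot u v| <= enorm u * enorm v.
Proof.
rewrite ler_norml dot_le_enorm andbT lerNl -dotNr -(enormN v).
exact: dot_le_enorm.
Qed.

Lemma ler_enormD u v : enorm (u + v) <= enorm u + enorm v.
Proof.
rewrite -(@ler_pXn2r _ 2) ?nnegrE ?addr_ge0 ?enorm_ge0// sqr_enormD.
have := dot_le_enorm u v; nra.
Qed.

Lemma ler_enormB u v : enorm u - enorm v <= enorm (u - v).
Proof. by rewrite lerBlDr -{1}(subrK v u) ler_enormD. Qed.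

Lemma enorm_clip_le lambda u : 0 <= lambda -> enorm (clip lambda u) <= lambda.
Proof.
move=> l0; rewrite /clip enormZ.
have [->|u0] := eqVneq (enorm u) 0; first by rewrite mulr0.
have up : 0 < enorm u by rewrite lt_def u0 enorm_ge0.
rewrite ger0_norm; last by rewrite le_min ler01 divr_ge0 ?enorm_ge0.
by rewrite -ler_pdivlMr// ge_min lexx orbT.
Qed.

Lemma clip_id lambda u : enorm u <= lambda -> clip lambda u = u.
Proof.
move=> ul; rewrite /clip.
have [/enorm_eq0 ->|u0] := eqVneq (enorm u) 0; first by rewrite scaler0.
have up : 0 < enorm u by rewrite lt_def u0 enorm_ge0.
by rewrite min_l ?scale1r// ler_pdivlMr// mul1r.
Qed.

Lemma enorm_clipB lambda u : 0 <= lambda -> lambda < enorm u ->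
  enorm (clip lambda u - u) = enorm u - lambda.
Proof.
move=> l0 lu; have up := le_lt_trans l0 lu.
have l1 : lambda / enorm u <= 1 by rewrite ler_pdivrMr// mul1r ltW.
rewrite /clip min_r// -[X in _ - X]scale1r -scalerBl enormZ.
rewrite ler0_norm ?subr_le0//.
by field; rewrite gt_eqF.
Qed.

End euclidean.
(** * Smooth functions *)

Section smooth.
Context (R : realType) (n : nat) (f : 'rV[R]_n -> R) (L : R).
Hypothesis hdiff : forall x, differentiable f x.
Hypothesis hsmooth : smooth L f.
Implicit Types x v : 'rV[R]_n.

Lemma derive_gradient x v : 'D_v f x = dot (gradient f x) v.
Proof.
rewrite deriveE// [in LHS](row_sum_delta v) linear_sum.
apply: eq_bigr => i _; rewrite linearZ/= mxE deriveE//.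
by rewrite mulrC.
Qed.

Lemma is_derive_line x v (s : R) :
  is_derive s 1 (fun t => f (x + t *: v)) (dot (gradient f (x + s *: v)) v).
Proof.
(* The difference quotient on the line is that of [f] at [x + s *: v] in the direction [v]. *)
have E : (fun h : R => h^-1 *: (f (x + (h *: 1 + s) *: v) - f (x + s *: v))) =
    (fun h : R => h^-1 *: (f (h *: v + (x + s *: v)) - f (x + s *: v))).
  apply/funext => h; congr (_ *: (f _ - _)).
  by rewrite scalerDl addrCA [h *: 1]mulr1.
apply: DeriveDef.
  rewrite /derivable /= E; exact: diff_derivable.
by rewrite /derive /= E -derive_gradient.
Qed.

(** Subtract from f(x + s v) its linear part in s and s^2 L |v|^2 / 2. By Cauchy-Schwarz and
    smoothness the derivative is nonpositive on (0, 1), and the mean value theorem gives g 1 <= g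
    0. *)
Lemma descent_lemma x v :
  f (x + v) <= f x + dot (gradient f x) v + L / 2 * enorm v ^+ 2.
Proof.
pose g (s : R) := f (x + s *: v) - s * dot (gradient f x) v
  - s ^+ 2 * (L / 2 * enorm v ^+ 2).
pose dg (s : R) := dot (gradient f (x + s *: v)) v - dot (gradient f x) v
  - (s * 2) * (L / 2 * enorm v ^+ 2).
have hg s : is_derive s (1 : R) (g : R -> R) (dg s).
  have df := is_derive_line x v s. apply: is_derive_eq.
  by rewrite /dg /GRing.scale /=; ring.
have [|c] := @MVT R g dg 0 1 ltr01.
  apply: derivable_within_continuous => s _; exact: ex_derive.
rewrite in_itv/= => /andP[c0 c1] gE.
suff dgc : dg c <= 0.
  have : g 1 - g 0 <= 0 by rewrite gE subr0 mulr1.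
  rewrite /g !scale0r scale1r addr0 expr1n expr0n/= !mul0r !mul1r; lra.
rewrite /dg -dotC -(dotC v) -dotBr.
have : dot v (gradient f (x + c *: v) - gradient f x) <=
    enorm v * (L * (c * enorm v)).
  apply: (le_trans (dot_le_enorm _ _)); rewrite ler_wpM2l ?enorm_ge0//.
  apply: (le_trans (hsmooth _ _)).
  by rewrite addrAC subrr add0r enormZ gtr0_norm.
rewrite (_ : c * 2 * _ = enorm v * (L * (c * enorm v))); last by field.
lra.
Qed.

(** A gradient step with step size 1/L lowers [f] by at least |grad f|^2 / (2L), yet cannot go below
    [fstar]. *)
Lemma sqr_gradient_le (fstar : R) x : 0 < L -> (forall y, fstar <= f y) ->
  enorm (gradient f x) ^+ 2 <= 2 * L * (f x - fstar).
Proof.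
move=> L0 hf.
have := le_trans (hf _) (descent_lemma x (- L^-1 *: gradient f x)).
rewrite dotZr -sqr_enorm enormZ normrN ger0_norm ?invr_ge0 ?(ltW L0)// exprMn.
set G := enorm _ ^+ 2.
rewrite (_ : f x + _ + _ = f x - G / (2 * L)); last by field; rewrite gt_eqF.
by rewrite lerBrDr -lerBrDl ler_pdivrMr ?mulr_gt0// mulrC.
Qed.

Lemma continuous_gradient (i : 'I_n) : 0 < L ->
  continuous (fun x => gradient f x ord0 i).
Proof.
move=> L0 x; apply/(@cvgrPdist_lt _ _ _ _ (nbhs_filter x)) => e e0.
(* Balls are taken in the sup norm: points at sup distance below r are at Euclidean distance at most
   sqrt(n) r, which is less than (n+1) r = e/L. Taking n+1 keeps the denominator nonzero when n =
   0. *)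
pose r := e / (L * n.+1%:R).
have r0 : 0 < r by rewrite divr_gt0// mulr_gt0.
have rE : e / L = n.+1%:R * r.
  rewrite /r; field.
  by rewrite (gt_eqF L0) -[1 + _]/(1%:R + _) -natrD pnatr_eq0.
clearbody r.
apply/nbhs_ballP; exists r => //= y [_ xy].
have -> : gradient f x ord0 i - gradient f y ord0 i =
  (gradient f x - gradient f y) ord0 i by rewrite !mxE.
apply: (le_lt_trans (coord_le_enorm _ _)).
apply: (le_lt_trans (hsmooth _ _)).
rewrite -ltr_pdivlMl// mulrC.
rewrite rE.
rewrite -(@ltr_pXn2r _ 2) ?nnegrE ?enorm_ge0 ?mulr_ge0 ?(ltW r0)//.
rewrite sqr_enorm /dot (@le_lt_trans _ _ (\sum_(j < n) r ^+ 2))//.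
  apply: ler_sum => j _; rewrite -expr2 -(real_normK (num_real _)).
  rewrite ler_pXn2r ?nnegrE ?(ltW r0)// !mxE.
  exact/ltW/xy.
rewrite sumr_const card_ord -[_ *+ n]mulr_natl [ltRHS]exprMn.
rewrite ltr_pM2r ?exprn_gt0//.
by rewrite -natrX ltr_nat -mulnn leq_pmulr.
Qed.

End smooth.
(** * The exponential moment of one step *)

Lemma expR_le_quadratic (R : realType) (x : R) :
  x <= 1 -> expR x <= 1 + x + 2 * x ^+ 2.
Proof.
move=> x1.
have h : 0 < 1 - x / 2 by lra.
(* e^x = (e^(-x/2))^-2 <= (1 - x/2)^-2 *)
have e2 : (1 - x / 2) ^+ 2 <= (expR x)^-1.
  rewrite -expRN (_ : - x = (- (x / 2)) * 2%:R); last by lra.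
  rewrite expRM_natr ler_pXn2r ?nnegrE ?expR_ge0 ?(ltW h)//.
  exact: expR_ge1Dx.
rewrite -[leLHS]invrK; apply: (@le_trans _ _ ((1 - x / 2) ^+ 2)^-1).
  by rewrite lef_pV2 ?posrE ?exprn_gt0 ?invr_gt0 ?expR_gt0.
rewrite -[leLHS]mul1r ler_pdivrMr ?exprn_gt0//.
(* What remains is a polynomial inequality; the difference of its sides factors so that its sign is
   visible for x <= 1. *)
rewrite -subr_ge0 (_ : _ - 1 = x ^+ 2 * ((1 - x) * (5 / 2 - x)) / 2).
  by rewrite divr_ge0// mulr_ge0 ?sqr_ge0// mulr_ge0//; lra.
by field.
Qed.

(** * Pointwise bounds on the clipping error *)

Section noise.
Context (R : realType) (n : nat) (p lambda : R) (G y : 'rV[R]_n).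
Hypotheses (hp : 1 < p <= 2) (lambda_gt0 : 0 < lambda).
Hypothesis hG : 2 * enorm G <= lambda.

Let r : R := enorm (y - G) / lambda.
Let nu : R := r `^ p.
Let theta := clip lambda y - G.

Let r_ge0 : 0 <= r. Proof. by rewrite divr_ge0 ?enorm_ge0 ?ltW. Qed.

Let enormE : enorm (y - G) = lambda * r.
Proof. by rewrite /r mulrC divfK// gt_eqF. Qed.

(** As p lies in (1, 2], r^p dominates r^2 below 1 and r above 1; the bounds on the clipping error
    split accordingly. *)
Let nu_small : r <= 1 -> r ^+ 2 <= nu.
Proof.
have [p1 p2] := andP hp.
move=> r1; have [r0|r0] := eqVneq r 0; first by rewrite r0 expr0n powR_ge0.
by rewrite -powR_mulrn// ger_powR// lt_def r0 r_ge0.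
Qed.

Let nu_large : 1 <= r -> r <= nu.
Proof. by move=> r1; have [p1 _] := andP hp; rewrite le1r_powR// ltW. Qed.

(** Since |G| <= lambda/2, clipping occurs only when the noise exceeds lambda/2. *)
Let clipped : lambda < enorm y -> 1 / 2 < r.
Proof.
move=> ly; rewrite /r ltr_pdivlMr//.
have := ler_enormB y G; move: ly hG; lra.
Qed.

Lemma enorm_noise_le : enorm theta <= 3 / 2 * lambda.
Proof.
have := enorm_clip_le y (ltW lambda_gt0).
have := ler_enormD (clip lambda y) (- G); rewrite enormN; move: hG; lra.
Qed.

(** If nu >= 1/4, the bound 3 lambda/2 on the error suffices. Otherwise r^2 <= nu < 1/4, so that r <
    1/2, no clipping occurs and the error is y - G, of norm lambda r. *)
Lemma sqr_enorm_noise_le : enorm theta ^+ 2 <= 9 * lambda ^+ 2 * nu.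
Proof.
have le94 : enorm theta ^+ 2 <= 9 / 4 * lambda ^+ 2.
  rewrite (_ : 9 / 4 * _ = (3 / 2 * lambda) ^+ 2); last by field.
  have t0 := enorm_ge0 theta.
  by rewrite ler_pXn2r ?nnegrE ?enorm_noise_le// mulr_ge0// ltW.
have l2 : 0 < lambda ^+ 2 by rewrite exprn_gt0.
have [nu4|nu4] := leP (1 / 4) nu.
  apply: (le_trans le94).
  have : 0 <= lambda ^+ 2 * (nu - 1 / 4) by rewrite mulr_ge0 ?subr_ge0// ltW.
  lra.
have r1 : r < 1.
  by rewrite ltNge; apply/negP => r1; move: r1 (nu_large r1) nu4; lra.
have r2 : r ^+ 2 <= nu by exact/nu_small/ltW.
have [yl|/clipped] := leP (enorm y) lambda; last first.
  by move=> r2'; exfalso; move: (sqr_ge0 (r - 1 / 2)) r2 r2' nu4; lra.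
rewrite /theta clip_id// enormE exprMn.
have : 0 <= lambda ^+ 2 * (nu - r ^+ 2) by rewrite mulr_ge0 ?subr_ge0// ltW.
have : 0 <= lambda ^+ 2 * nu by rewrite mulr_ge0 ?powR_ge0// ltW.
lra.
Qed.

(** Clipping removes |y| - lambda <= |y - G| = lambda r. When it occurs, r > 1/2, whence r <= 2 r^2
    <= 2 nu if r < 1, and r <= nu otherwise. *)
Lemma enorm_clip_bias_le : enorm (clip lambda y - y) <= 2 * lambda * nu.
Proof.
have [yl|ly] := leP (enorm y) lambda.
  by rewrite clip_id// subrr enorm0 !mulr_ge0 ?powR_ge0// ltW.
rewrite enorm_clipB ?(ltW lambda_gt0)//; have r2 := clipped ly.
have -> : 2 * lambda * nu = lambda * (2 * nu) by ring.
apply: (@le_trans _ _ (lambda * r)).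
  rewrite -enormE; move: (ler_enormB y G) (enorm_ge0 G) hG; lra.
rewrite ler_pM2l//; have [/ltW r1|r1] := ltP r 1; last first.
  by move: r1 (nu_large r1); lra.
move: (sqr_ge0 (r - 1 / 2)) r2 (nu_small r1); lra.
Qed.

End noise.
Lemma powR_div (R : realType) (x y p : R) : 0 <= x -> 0 <= y ->
  (x / y) `^ p = x `^ p * y `^ (- p).
Proof.
move=> x0 y0; rewrite powRM ?invr_ge0//; congr (_ * _).
by rewrite -(powR_inv1 y0) -powRrM mulN1r.
Qed.

(** * Measurability of the vector operations *)

Section measurable_euclidean.
Context (R : realType) (n : nat) d (T : measurableType d).
Implicit Types h k : T -> 'rV[R]_n.

Lemma measurable_coord_comp h (i : 'I_n) :
  measurable_fun setT h -> measurable_fun setT (fun t => h t ord0 i).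
Proof. exact: measurableT_comp (measurable_coord i). Qed.

Lemma measurable_rVB h k : measurable_fun setT h -> measurable_fun setT k ->
  measurable_fun setT (fun t => h t - k t).
Proof.
move=> mh mk; apply: measurable_fun_rV => i.
rewrite (_ : (fun _ => _) = (fun t => h t ord0 i - k t ord0 i)); last first.
  by apply/funext => t; rewrite !mxE.
by apply: measurable_funB; exact: measurable_coord_comp.
Qed.

Lemma measurable_rVZ (c : T -> R) h :
  measurable_fun setT c -> measurable_fun setT h ->
  measurable_fun setT (fun t => c t *: h t).
Proof.
move=> mc mh; apply: measurable_fun_rV => i.
rewrite (_ : (fun _ => _) = (fun t => c t * h t ord0 i)); last first.
  by apply/funext => t; rewrite !mxE.
by apply: measurable_funM => //; exact: measurable_coord_comp.
Qed.

Lemma measurable_dot h k : measurable_fun setT h -> measurable_fun setT k ->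
  measurable_fun setT (fun t => dot (h t) (k t)).
Proof.
move=> mh mk; apply: measurable_sum => i.
by apply: measurable_funM; exact: measurable_coord_comp.
Qed.

Lemma measurable_enorm h : measurable_fun setT h ->
  measurable_fun setT (fun t => enorm (h t)).
Proof.
move=> mh; rewrite (_ : (fun _ => _) = (fun t => Num.sqrt (dot (h t) (h t)))).
  have msqrt : measurable_fun setT (@Num.sqrt R).
    by apply: continuous_measurable_fun; exact: sqrt_continuous.
  exact: (measurableT_comp msqrt (measurable_dot mh mh)).
by apply/funext => t; rewrite -sqr_enorm sqrtr_sqr ger0_norm ?enorm_ge0.
Qed.

Lemma measurable_clip lambda h : measurable_fun setT h ->
  measurable_fun setT (fun t => clip lambda (h t)).
Proof.
move=> mh; apply: measurable_rVZ => //.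
apply: measurable_minr => //; apply: measurable_funM => //.
(* The inverse is written as the power -1, with which it agrees also at 0. *)
rewrite (_ : (fun _ => _) = (fun t => enorm (h t) `^ (-1))); last first.
  by apply/funext => t; rewrite powR_inv1 ?enorm_ge0.
exact: measurableT_comp (measurable_powR _) (measurable_enorm mh).
Qed.

End measurable_euclidean.

(** * The exponential moment of the noise in one query *)

Section one_query.
Context (R : realType) (n : nat) (p lambda sigma a c : R) (G : 'rV[R]_n).
Hypotheses (hp : 1 < p <= 2) (lambda_gt0 : 0 < lambda).
Hypothesis sigma_ge0 : 0 <= sigma.
Hypothesis hG : 2 * enorm G <= lambda.
Hypotheses (a_ge0 : 0 <= a) (c_ge0 : 0 <= c).
Hypothesis ha : a * enorm G * (3 / 2 * lambda) <= 3 / 4.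
Hypothesis hc : c * (3 / 2 * lambda) ^+ 2 <= 1 / 8.

(** The factor of nu in the bound below: the clipping bias gives the first summand, the terms
    quadratic in the error give the second. In use, [a] is kappa eta and [c] is kappa L eta^2. *)
Let K := 2 * a * enorm G * lambda
  + 9 * lambda ^+ 2 * (4 * (a * enorm G) ^+ 2 + 2 * c).

Let K_ge0 : 0 <= K.
Proof.
have la0 := ltW lambda_gt0.
by rewrite addr_ge0 ?mulr_ge0 ?addr_ge0 ?mulr_ge0 ?sqr_ge0 ?enorm_ge0.
Qed.

Let X (y : 'rV[R]_n) := - a * dot G (clip lambda y - G)
  + c * enorm (clip lambda y - G) ^+ 2.

(** Apply e^u <= 1 + u + 2u^2 to u = - u1 + u2, which is at most 3/4 + 1/8. In u1 the error splits
    into the bias clip(y) - y, bounded by 2 lambda nu, and y - G, which is kept because it has mean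
    zero. *)
Lemma expR_noise_le (y : 'rV[R]_n) : expR (X y) <=
  1 - a * dot G (y - G) + K * (enorm (y - G) / lambda) `^ p.
Proof.
have t1 := enorm_noise_le y lambda_gt0 hG.
have t2 := sqr_enorm_noise_le y hp lambda_gt0 hG.
have t3 := enorm_clip_bias_le y hp lambda_gt0 hG.
rewrite /X; set nu := (_ / _) `^ p in t2 t3 *.
set theta := clip lambda y - G in t1 t2 *.
have G0 := enorm_ge0 G.
have th0 := enorm_ge0 theta.
pose u1 := a * dot G theta; pose u2 := c * enorm theta ^+ 2.
rewrite mulNr -/u1 -/u2.
have u1le : `|u1| <= a * enorm G * enorm theta.
  by rewrite normrM (ger0_norm a_ge0) -mulrA ler_wpM2l// norm_dot_le.
have u1b : `|u1| <= 3 / 4.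
  apply: (le_trans u1le); apply: le_trans ha; rewrite ler_wpM2l// mulr_ge0//.
have u2b : u2 <= 1 / 8.
  by apply: le_trans hc; rewrite ler_wpM2l// ler_pXn2r ?nnegrE// mulr_ge0// ltW.
have u20 : 0 <= u2 by rewrite mulr_ge0// sqr_ge0.
have u1s : u1 ^+ 2 <= (a * enorm G) ^+ 2 * (9 * lambda ^+ 2 * nu).
  apply: (@le_trans _ _ ((a * enorm G) ^+ 2 * enorm theta ^+ 2)).
    by rewrite -exprMn -(real_normK (num_real u1)) ler_pXn2r ?nnegrE ?mulr_ge0.
  by rewrite ler_wpM2l// sqr_ge0.
have u2s : u2 <= c * (9 * lambda ^+ 2 * nu) by rewrite ler_wpM2l.
have u1d : - u1 <= - (a * dot G (y - G)) + 2 * a * enorm G * lambda * nu.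
  have thetaE : theta = (clip lambda y - y) + (y - G) by rewrite addrA subrK.
  rewrite /u1 thetaE dotDr mulrDr opprD addrC lerD2l.
  apply: (@le_trans _ _ (a * (enorm G * enorm (clip lambda y - y)))).
    rewrite -mulrN ler_wpM2l// -dotNr -(enormN (clip lambda y - y)).
    exact: dot_le_enorm.
  have -> : 2 * a * enorm G * lambda * nu =
    a * (enorm G * (2 * lambda * nu)) by ring.
  by rewrite !ler_wpM2l.
have /expR_le_quadratic : - u1 + u2 <= 1 by move: u1b; rewrite ler_norml; lra.
move=> h; apply: (le_trans h).
(* The quadratic term is at most 4 u1^2 + 4 u2^2, and u2 <= 1/8 gives 4 u2^2 <= u2/2, so that the
   total in u2 is at most 2 u2. *)
have : 0 <= u2 * (1 / 8 - u2) by rewrite mulr_ge0// subr_ge0.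
have := sqr_ge0 (u1 + u2).
rewrite /K; move: u1d u2s u1s; lra.
Qed.

Variable mu : {measure set 'rV[R]_n -> \bar R}.
Hypothesis mu1 : mu setT = 1%E.
Hypothesis mu_mean : forall i, (\int[mu]_y (y ord0 i)%:E = (G ord0 i)%:E)%E.
Hypothesis mu_noise :
  (\int[mu]_y (enorm (y - G) `^ p)%:E <= (sigma `^ p)%:E)%E.

Let measurable_noise : measurable_fun setT (fun y : 'rV[R]_n => enorm (y - G)).
Proof. by apply: measurable_enorm; exact: measurable_rVB. Qed.

Let integrable_cst (r : R) : mu.-integrable setT (fun=> r%:E).
Proof.
apply/integrableP; split => //.
by rewrite integral_cst//= mu1 mule1 ltry.
Qed.

Let integrable_noise :
  mu.-integrable setT (fun y => (enorm (y - G) `^ p)%:E).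
Proof.
apply/integrableP; split.
  by apply/measurable_EFinP; exact: measurableT_comp (measurable_powR p) _.
under eq_integral do rewrite gee0_abs ?lee_fin ?powR_ge0//.
exact: le_lt_trans mu_noise (ltry _).
Qed.

(** The moment bound provides the domination: |y_i| <= |G_i| + |y - G|, and t <= 1 + t^p for t >=
    0. *)
Let integrable_coord i : mu.-integrable setT (fun y => (y ord0 i)%:E).
Proof.
apply: (@le_integrable _ _ _ mu setT _ _
  (fun y => (`|G ord0 i| + 1)%:E + (enorm (y - G) `^ p)%:E)%E) => //.
- by apply/measurable_EFinP; exact: measurable_coord.
- move=> y _.
  rewrite /= lee_fin (@ger0_norm _ (_ + _)); last first.
    by rewrite addr_ge0 ?powR_ge0 ?addr_ge0.
  have : `|y ord0 i| <= `|G ord0 i| + enorm (y - G).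
    rewrite -[y ord0 i](subrKC (G ord0 i)); apply: (le_trans (ler_normD _ _)).
    by rewrite lerD2l; have := coord_le_enorm (y - G) i; rewrite !mxE.
  suff : enorm (y - G) <= 1 + enorm (y - G) `^ p by lra.
  have [N1|/ltW N1] := leP (enorm (y - G)) 1.
    by rewrite (le_trans N1)// lerDl powR_ge0.
  by have [p1 _] := andP hp; rewrite (le_trans (le1r_powR N1 (ltW p1)))// lerDr.
- exact: integrableD.
Qed.

Lemma integral_dot_noise :
  mu.-integrable setT (fun y => (dot G (y - G))%:E) /\
  (\int[mu]_y (dot G (y - G))%:E = 0)%E.
Proof.
have -> : (fun y => (dot G (y - G))%:E) = (fun y =>
    \sum_i (G ord0 i)%:E * ((y ord0 i)%:E - (G ord0 i)%:E))%E.
  apply/funext => y; rewrite /dot -sumEFin; apply: eq_bigr => i _.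
  by rewrite !mxE EFinM EFinB.
have int_i i : mu.-integrable setT
    (fun y => (G ord0 i)%:E * ((y ord0 i)%:E - (G ord0 i)%:E))%E.
  by apply: integrableZl => //; exact: integrableB.
split; first exact: integrable_sum.
rewrite integral_sum// big1// => i _.
rewrite integralZl//; last exact: integrableB.
rewrite integralB// mu_mean integral_cst// mu1 mule1 subee// mule0//.
Qed.

(** Integrating the pointwise bound removes the mean-zero term, and the moment bound turns nu into
    (sigma/lambda)^p. *)
Lemma integral_expR_noise_le :
  (\int[mu]_y (expR (X y))%:E <= (1 + K * (sigma / lambda) `^ p)%:E)%E.
Proof.
have [idot dot0] := integral_dot_noise.
have mX : measurable_fun setT X.
  have mth : measurable_fun setT (fun y : 'rV[R]_n => clip lambda y - G).
    by apply: measurable_rVB => //; exact: measurable_clip.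
  apply: measurable_funD; apply: measurable_funM => //.
    exact: measurable_dot.
  exact/measurable_funX/measurable_enorm.
pose b := K * lambda `^ (- p).
apply: (@le_trans _ _ (\int[mu]_y ((1%:E - a%:E * (dot G (y - G))%:E)
    + b%:E * (enorm (y - G) `^ p)%:E))%E).
  apply: ge0_le_integral => //.
  - by apply/measurable_EFinP; exact: measurableT_comp.
  - apply: (measurable_int mu); apply: integrableD => //; last first.
      exact: integrableZl.
    by apply: integrableB => //; exact: integrableZl.
  - move=> y _; rewrite -EFinM -EFinB -EFinM -EFinD lee_fin.
    apply: (le_trans (expR_noise_le y)).
    by rewrite powR_div ?enorm_ge0 ?(ltW lambda_gt0)// /b; lra.
rewrite integralD//; last 2 first.
- by apply: integrableB => //; exact: integrableZl.
- exact: integrableZl.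
rewrite integralB//; last exact: integrableZl.
rewrite !integralZl// dot0 mule0 sube0 integral_cst// mu1 mul1e.
apply: (@le_trans _ _ (1%:E + b%:E * (sigma `^ p)%:E)%E).
  by rewrite leeD2l// lee_wpmul2l// lee_fin mulr_ge0 ?powR_ge0.
rewrite -EFinM -EFinD lee_fin powR_div ?(ltW lambda_gt0)// /b; lra.
Qed.

End one_query.
(** The change Q_(t+1) - Q_t of the energy when the query at x_t = [x] is answered by [y]. *)
Definition energy_increment (R : realType) (n : nat) (f : 'rV[R]_n -> R)
    (lambda eta : R) (x y : 'rV[R]_n) : R :=
  f (x - eta *: clip lambda y) - f x + eta / 2 * enorm (gradient f x) ^+ 2.

Section measurable_smooth.
Context (R : realType) (n : nat) (f : 'rV[R]_n -> R) (L : R).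
Hypothesis L_gt0 : 0 < L.
Hypothesis hdiff : forall x, differentiable f x.
Hypothesis hsmooth : smooth L f.

Lemma measurable_differentiable : measurable_fun setT f.
Proof.
apply: continuous_measurable_rV => x; exact: differentiable_continuous.
Qed.

Lemma measurable_gradient : measurable_fun setT (gradient f).
Proof.
apply: measurable_fun_rV => i; apply: continuous_measurable_rV.
exact: continuous_gradient hsmooth i L_gt0.
Qed.

Context d (T : measurableType d).

Lemma measurable_energy_increment lambda eta (h k : T -> 'rV[R]_n) :
  measurable_fun setT h -> measurable_fun setT k ->
  measurable_fun setT (fun t => energy_increment f lambda eta (h t) (k t)).
Proof.
move=> mh mk; have mf := measurable_differentiable.
apply: measurable_funD.
  apply: measurable_funB; last exact: measurableT_comp mf mh.
  apply: (measurableT_comp mf); apply: measurable_rVB => //.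
  by apply: measurable_rVZ => //; exact: measurable_clip.
apply: measurable_funM => //; apply: measurable_funX; apply: measurable_enorm.
exact: measurableT_comp measurable_gradient mh.
Qed.

End measurable_smooth.

(** * The exponential moment of the energy increment *)

Section one_step.
Context (R : realType) (n : nat) (f : 'rV[R]_n -> R) (L fstar : R).
Hypothesis L_gt0 : 0 < L.
Hypothesis hdiff : forall x, differentiable f x.
Hypothesis hsmooth : smooth L f.
Hypothesis hfstar : forall x, fstar <= f x.
(* S stands for sqrt (L * Delta1). *)
Variables (p sigma lambda eta kappa S : R).
Hypotheses (hp : 1 < p <= 2) (sigma_ge0 : 0 <= sigma) (lambda_gt0 : 0 < lambda).
Hypotheses (eta_ge0 : 0 <= eta) (kappa_ge0 : 0 <= kappa) (S_ge0 : 0 <= S).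
Hypothesis lambda_ge : 4 * S <= lambda.
Hypothesis eta_le : 4 * L * eta <= 1.
Hypothesis kappa_eta_le : kappa * eta * lambda * S <= 1 / 4.
Hypothesis kappa_eta2_le :
  kappa * L * eta ^+ 2 * (3 / 2 * lambda) ^+ 2 <= 1 / 8.

Variable x : 'rV[R]_n.
Hypothesis gap : L * (f x - fstar) <= 2 * S ^+ 2.
Let G := gradient f x.

Let enorm_gradient_le : enorm G <= 2 * S.
Proof.
rewrite -(@ler_pXn2r _ 2) ?nnegrE ?enorm_ge0 ?mulr_ge0//.
have := sqr_gradient_le hdiff hsmooth x L_gt0 hfstar.
rewrite -/G; move: gap; lra.
Qed.

(** The descent lemma along - eta (G + theta), with |G + theta|^2 <= 2 |G|^2 + 2 |theta|^2. It gains
    - eta |G|^2, half of which pays for the squared gradient in the energy. *)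
Lemma energy_increment_le (y : 'rV[R]_n) :
  kappa * energy_increment f lambda eta x y <=
    kappa * (L * eta ^+ 2 - eta / 2) * enorm G ^+ 2 +
    (- (kappa * eta) * dot G (clip lambda y - G)
      + kappa * L * eta ^+ 2 * enorm (clip lambda y - G) ^+ 2).
Proof.
set theta := clip lambda y - G.
have clipE : clip lambda y = G + theta by rewrite addrC subrK.
have := descent_lemma hdiff hsmooth x (- eta *: clip lambda y).
rewrite scaleNr dotNr dotZr enormN enormZ exprMn (real_normK (num_real _)).
rewrite -/G clipE dotDr -sqr_enorm => h.
have h2 : enorm (G + theta) ^+ 2 <= 2 * enorm G ^+ 2 + 2 * enorm theta ^+ 2.
  rewrite sqr_enormD.
  have := sqr_ge0 (enorm (G - theta)).
  rewrite sqr_enormD dotNr enormN; lra.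
have h3 : L / 2 * (eta ^+ 2 * enorm (G + theta) ^+ 2) <=
    L / 2 * (eta ^+ 2 * (2 * enorm G ^+ 2 + 2 * enorm theta ^+ 2)).
  by rewrite ler_wpM2l ?divr_ge0 ?(ltW L_gt0)// ler_wpM2l ?sqr_ge0.
rewrite (_ : _ + _ = kappa * ((L * eta ^+ 2 - eta / 2) * enorm G ^+ 2
  - eta * dot G theta + L * eta ^+ 2 * enorm theta ^+ 2)); last by ring.
rewrite ler_wpM2l// /energy_increment -/G clipE; move: h h3; lra.
Qed.

Variable mu : {measure set 'rV[R]_n -> \bar R}.
Hypothesis mu1 : mu setT = 1%E.
Hypothesis mu_mean : forall i, (\int[mu]_y (y ord0 i)%:E = (G ord0 i)%:E)%E.
Hypothesis mu_noise :
  (\int[mu]_y (enorm (y - G) `^ p)%:E <= (sigma `^ p)%:E)%E.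

Let z := (sigma / lambda) `^ p.

(** A bound, free of the gradient, on the logarithm of the exponential moment of one step; [w] is
    (sigma/lambda)^p. The first summand comes from the bias, the second from the quadratic terms. *)
Definition step_cost (w : R) : R :=
  4 * kappa * eta * (lambda * w) ^+ 2 +
  9 * lambda ^+ 2 * w *
    (16 * (kappa * eta * S) ^+ 2 + 2 * kappa * L * eta ^+ 2).

Lemma integral_expR_energy_le :
  (\int[mu]_y (expR (kappa * energy_increment f lambda eta x y))%:E <=
     (expR (step_cost ((sigma / lambda) `^ p)))%:E)%E.
Proof.
rewrite -/z.
pose a := kappa * eta; pose c := kappa * L * eta ^+ 2.
have a0 : 0 <= a by rewrite mulr_ge0.
have c0 : 0 <= c by rewrite !mulr_ge0 ?sqr_ge0 ?(ltW L_gt0).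
have G0 := enorm_ge0 G.
have hG : 2 * enorm G <= lambda by move: enorm_gradient_le lambda_ge; lra.
have ha : a * enorm G * (3 / 2 * lambda) <= 3 / 4.
  have : a * lambda * enorm G <= a * lambda * (2 * S).
    by rewrite ler_wpM2l// mulr_ge0// ltW.
  by move: kappa_eta_le; rewrite /a; lra.
have z0 : 0 <= z by exact: powR_ge0.
have := integral_expR_noise_le hp lambda_gt0 sigma_ge0 hG a0 c0 ha kappa_eta2_le
  mu1 mu_mean mu_noise.
rewrite -/z; set K := (_ + 9 * _ * _) => hK.
(* The deterministic part [b] of the exponent is factored out; it absorbs the bias. *)
pose b := kappa * (L * eta ^+ 2 - eta / 2) * enorm G ^+ 2.
pose X y :=
  - a * dot G (clip lambda y - G) + c * enorm (clip lambda y - G) ^+ 2.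
have mX : measurable_fun setT X.
  have mth : measurable_fun setT (fun y : 'rV[R]_n => clip lambda y - G).
    by apply: measurable_rVB => //; exact: measurable_clip.
  apply: measurable_funD; apply: measurable_funM => //.
    exact: measurable_dot.
  exact/measurable_funX/measurable_enorm.
apply: (@le_trans _ _ (\int[mu]_y ((expR b)%:E * (expR (X y))%:E))%E).
  apply: ge0_le_integral => //.
  - apply/measurable_EFinP/measurableT_comp => //; apply: measurable_funM => //.
    exact: (measurable_energy_increment L_gt0 hdiff hsmooth).
  - apply/measurable_EFinP; apply: measurable_funM => //.
    exact: measurableT_comp.
  - move=> y _; rewrite -EFinM lee_fin -expRD ler_expR.
    exact: energy_increment_le.
rewrite ge0_integralZl//; last first.
  by apply/measurable_EFinP; exact: measurableT_comp.
apply: (@le_trans _ _ ((expR b)%:E * (1 + K * z)%:E)%E).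
  by rewrite lee_wpmul2l// lee_fin expR_ge0.
rewrite -EFinM lee_fin.
apply: (@le_trans _ _ (expR b * expR (K * z))).
  by rewrite ler_wpM2l ?expR_ge0 ?expR_ge1Dx.
rewrite -expRD ler_expR /b /K /step_cost.
have h1 : (a * enorm G) ^+ 2 <= 4 * (a * S) ^+ 2.
  have -> : 4 * (a * S) ^+ 2 = (a * (2 * S)) ^+ 2 by ring.
  by rewrite ler_pXn2r ?nnegrE ?mulr_ge0// ler_wpM2l.
have h2 : 0 <= lambda ^+ 2 * z * (4 * (a * S) ^+ 2 - (a * enorm G) ^+ 2).
  by apply: mulr_ge0; rewrite ?subr_ge0// mulr_ge0 ?sqr_ge0.
(* A completed square: 2 a |G| lambda z <= a |G|^2/4 + 4 a (lambda z)^2. By [h4], [b] is at most - a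
   |G|^2/4, so these terms in |G|^2 cancel. *)
have h3 : 0 <= a * (enorm G / 2 - 2 * (lambda * z)) ^+ 2.
  by rewrite mulr_ge0 ?sqr_ge0.
have h4 : 0 <= a * enorm G ^+ 2 * (1 - 4 * L * eta).
  by apply: mulr_ge0; rewrite ?subr_ge0// mulr_ge0 ?sqr_ge0.
move: h2 h3 h4; rewrite /a /c; lra.
Qed.

End one_step.
(** * The stopped exponential process *)

Section kernel_precomp.
Context d1 d2 d3 (X : measurableType d1) (Z : measurableType d2)
  (Y : measurableType d3) (R : realType).
Variables (k : R.-pker Z ~> Y) (q : X -> Z).
Hypothesis mq : measurable_fun setT q.

(** Makes the conditional law of an answer, given the past, a kernel on the space of histories. The
    measurability of [q] is an argument so that the kernel structures can be attached to the
    term. *)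
Definition kernel_precomp (_ : measurable_fun setT q) (x : X) :
  {measure set Y -> \bar R} := k (q x).

Let measurable_kernel_precomp U : measurable U ->
  measurable_fun setT (kernel_precomp mq ^~ U).
Proof. by move=> mU; exact: measurableT_comp (measurable_kernel k U mU) mq. Qed.

HB.instance Definition _ :=
  isKernel.Build _ _ X Y R (kernel_precomp mq) measurable_kernel_precomp.

Let kernel_precomp_prob x : kernel_precomp mq x setT = 1%E.
Proof. exact: prob_kernel. Qed.

HB.instance Definition _ :=
  Kernel_isProbability.Build _ _ X Y R (kernel_precomp mq) kernel_precomp_prob.

End kernel_precomp.

(** * The filtration generated by the answers *)

Section history.
Context (R : realType) (n : nat) d (Omega : measurableType d).
Variable g : nat -> Omega -> 'rV[R]_n.

(* <<s history_gen t>> is history g t. *)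
Definition history_gen (t : nat) : set (set Omega) :=
  \bigcup_(s in [set s | (1 <= s < t)%N])
    preimage_set_system setT (g s) measurable.

(** A copy of [Omega] carrying the sigma-algebra of the history, so that dependence on the past
    alone is expressed by [measurable_fun]. *)
Definition history_type (t : nat) := g_sigma_algebraType (history_gen t).

HB.instance Definition _ t := Measurable.on (history_type t).

Lemma history_answer (t : nat) : (0 < t)%N ->
  measurable_fun [set: history_type t.+1] (g t).
Proof.
move=> t0 _ B mB; rewrite setTI; apply: sub_sigma_algebra.
by exists t; [rewrite /= t0 ltnSn|exists B => //; rewrite setTI].
Qed.

Lemma historyS d' (Y : measurableType d') (t : nat) (h : Omega -> Y) :
  measurable_fun [set: history_type t] h ->
  measurable_fun [set: history_type t.+1] h.
Proof.
move=> mh _ B mB; have := mh measurableT B mB.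
rewrite !setTI; apply: sub_smallest2r; first exact: smallest_sigma_algebra.
move=> A [s /= /andP[s1 st] gA]; exists s => //=.
by rewrite s1 ltnW.
Qed.

(** The history at [t] involves only answers before [t], so [t] may be as large as T+1. *)
Lemma history_sub d' (Y : measurableType d') (t T : nat) (h : Omega -> Y) :
  (forall s, (1 <= s <= T)%N -> measurable_fun setT (g s)) -> (t <= T.+1)%N ->
  measurable_fun [set: history_type t] h -> measurable_fun [set: Omega] h.
Proof.
move=> mg tT mh _ B mB; have := mh measurableT B mB.
rewrite !setTI; apply: smallest_sub; first exact: sigma_algebra_measurable.
move=> A [s /= /andP[s1 st] [C mC <-]]; apply: mg => //.
by rewrite s1 -ltnS (leq_trans st).
Qed.

End history.

(** * The supermartingale estimate and Markov's inequality *)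

Section tail_bound.
Context (R : realType) (n : nat) (f : 'rV[R]_n -> R) (L fstar : R).
Hypothesis L_gt0 : 0 < L.
Hypothesis hdiff : forall x, differentiable f x.
Hypothesis hsmooth : smooth L f.
Hypothesis hfstar : forall x, fstar <= f x.
Variables (p sigma lambda eta kappa S : R).
Hypotheses (hp : 1 < p <= 2) (sigma_ge0 : 0 <= sigma) (lambda_gt0 : 0 < lambda).
Hypotheses (eta_gt0 : 0 < eta) (kappa_gt0 : 0 < kappa) (S_ge0 : 0 <= S).
Hypothesis lambda_ge : 4 * S <= lambda.
Hypothesis eta_le : 4 * L * eta <= 1.
Hypothesis kappa_eta_le : kappa * eta * lambda * S <= 1 / 4.
Hypothesis kappa_eta2_le :
  kappa * L * eta ^+ 2 * (3 / 2 * lambda) ^+ 2 <= 1 / 8.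
Variable oracle : R.-pker 'rV[R]_n ~> 'rV[R]_n.
Hypothesis hunbiased : unbiased f oracle.
Hypothesis hnoise : bounded_noise f oracle p sigma.
Variables (T : nat) (x1 : 'rV[R]_n).
Let Delta1 := f x1 - fstar.
Hypothesis Delta1E : L * Delta1 = S ^+ 2.
Context (disp : measure_display) (Omega : measurableType disp)
  (P : probability Omega R).
Variables (x g : nat -> Omega -> 'rV[R]_n).
Hypothesis hrun : clipped_sgd P oracle T x1 (fun=> eta) (fun=> lambda) x g.

Let rho := step_cost L lambda eta kappa S ((sigma / lambda) `^ p).
Let inc := energy_increment f lambda eta.
Let thr := expR (kappa * (2 * Delta1)).

Let energy (t : nat) (w : Omega) : R :=
  f (x t w) - fstar +
  eta / 2 * \sum_(1 <= s < t) enorm (gradient f (x s w)) ^+ 2.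

(* exp (kappa * energy) frozen once it exceeds thr; index k is time k.+1. *)
Fixpoint stopped (k : nat) (w : Omega) : R :=
  if k is k'.+1 then
    if thr < stopped k' w then stopped k' w
    else stopped k' w * expR (kappa * inc (x k w) (g k w))
  else expR (kappa * Delta1).

Let stopped_ge0 k w : 0 <= stopped k w.
Proof.
elim: k => [|k IH] /=; first exact: expR_ge0.
by case: ifP => // _; rewrite mulr_ge0 ?expR_ge0.
Qed.

Let energyS t w : (1 <= t <= T)%N ->
  energy t.+1 w = energy t w + inc (x t w) (g t w).
Proof.
move=> tT; rewrite /energy /inc /energy_increment (sgd_step hrun tT).
by case/andP: tT => t1 _; rewrite big_nat_recr//= mulrDr; ring.
Qed.

(** Once above [thr] the process stays there; being at most [thr] at index [k] thus means that it
    was never frozen, and the increments of the energy telescope. *)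
Let stoppedE k w : (k <= T)%N -> stopped k w <= thr ->
  stopped k w = expR (kappa * energy k.+1 w).
Proof.
elim: k => [_ _|k IH kT] /=.
  by rewrite /energy big_geq// mulr0 addr0 (sgd_init hrun).
case: ifPn => [h1 h2|]; first by move: (lt_le_trans h1 h2); rewrite ltxx.
rewrite -leNgt => h _; rewrite (IH (ltnW kT) h) -expRD -mulrDr.
by rewrite [energy k.+2 w]energyS.
Qed.

(** x_(t+1) is a function of x_t and g_t, and g_t enters the history at t+1. *)
Let measurable_iterate t : (1 <= t <= T.+1)%N ->
  measurable_fun [set: history_type g t] (x t).
Proof.
elim: t => // -[_ _|t IH tT].
  by rewrite (_ : x 1 = fun=> x1)//; apply/funext => w; rewrite (sgd_init hrun).
have tT' : (1 <= t.+1 <= T)%N by [].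
rewrite (_ : x t.+2 = fun w => x t.+1 w - eta *: clip lambda (g t.+1 w)).
  apply: measurable_rVB; first by apply: historyS; apply: IH; exact: ltnW.
  by apply: measurable_rVZ => //; apply: measurable_clip; exact: history_answer.
by apply/funext => w; rewrite (sgd_step hrun tT').
Qed.

(** The next value as a function of the past and of a fresh answer, the form that [disintegration]
    integrates. *)
Let measurable_step k : (k < T)%N ->
  measurable_fun [set: history_type g k.+1] (stopped k) ->
  measurable_fun [set: history_type g k.+1 * 'rV[R]_n]
    (fun wy => if thr < stopped k wy.1 then stopped k wy.1
       else stopped k wy.1 * expR (kappa * inc (x k.+1 wy.1) wy.2)).
Proof.
move=> kT ms.
have ms1 : measurable_fun [set: history_type g k.+1 * 'rV[R]_n]
  (fun wy => stopped k wy.1) by exact: measurableT_comp ms measurable_fst.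
apply: measurable_fun_ifT => //; first exact: measurable_fun_ltr.
apply: measurable_funM => //; apply: measurableT_comp => //.
apply: measurable_funM => //.
apply: (measurable_energy_increment L_gt0 hdiff hsmooth) => //.
have mx : measurable_fun [set: history_type g k.+1] (x k.+1).
  by apply: measurable_iterate; rewrite /= ltnW.
exact: measurableT_comp mx measurable_fst.
Qed.

Let measurable_stopped k : (k <= T)%N ->
  measurable_fun [set: history_type g k.+1] (stopped k).
Proof.
elim: k => [_|k IH kT]; first exact: measurable_cst.
have ms := measurable_step kT (IH (ltnW kT)).
have mpair : measurable_fun [set: history_type g k.+2]
    (fun w => ((w, g k.+1 w) : history_type g k.+1 * 'rV[R]_n)).
  apply: measurable_fun_pair; last exact: history_answer.
  by apply: historyS; exact: measurable_id.
exact: measurableT_comp ms mpair.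
Qed.

Let rho_ge0 : 0 <= rho.
Proof.
have z0 : 0 <= (sigma / lambda) `^ p by exact: powR_ge0.
have k0 := ltW kappa_gt0; have e0 := ltW eta_gt0; have l0 := ltW L_gt0.
have la0 := ltW lambda_gt0.
rewrite /rho /step_cost addr_ge0//; first by rewrite !mulr_ge0 ?sqr_ge0.
apply: mulr_ge0; first by rewrite !mulr_ge0 ?sqr_ge0.
by apply: addr_ge0; rewrite !mulr_ge0 ?sqr_ge0.
Qed.

(** Before freezing, the energy is at most 2 Delta1; dropping its nonnegative sum bounds the gap, as
    the one-step estimate requires. *)
Let gap_stopped k w : (k <= T)%N -> stopped k w <= thr ->
  L * (f (x k.+1 w) - fstar) <= 2 * S ^+ 2.
Proof.
move=> kT sk; rewrite -Delta1E mulrCA ler_pM2l//.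
move: (sk); rewrite (stoppedE kT sk) ler_expR ler_pM2l//.
apply: le_trans; rewrite /energy lerDl mulr_ge0 ?divr_ge0 ?(ltW eta_gt0)//.
by apply: sumr_ge0 => i _; exact: sqr_ge0.
Qed.

(** Given the history, the answer has the law of the oracle at the iterate, so that the one-step
    estimate applies up to the threshold; above it the process is constant and exp(rho) >= 1. *)
Lemma integral_stoppedS k : (k < T)%N ->
  (\int[P]_w (stopped k.+1 w)%:E <=
     (expR rho)%:E * \int[P]_w (stopped k w)%:E)%E.
Proof.
move=> kT.
have kT1 : (1 <= k.+1 <= T)%N by [].
pose phi (wy : history_type g k.+1 * 'rV[R]_n) : R :=
  if thr < stopped k wy.1 then stopped k wy.1
  else stopped k wy.1 * expR (kappa * inc (x k.+1 wy.1) wy.2).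
have phi0 z : 0 <= phi z.
  by rewrite /phi; case: ifP => // _; rewrite mulr_ge0 ?expR_ge0.
have ms := measurable_stopped (ltnW kT).
have mphi : measurable_fun setT phi by exact: measurable_step.
have mx : measurable_fun [set: history_type g k.+1] (x k.+1).
  by apply: measurable_iterate; rewrite /= ltnW.
(* The identity, from [Omega] to its copy with the coarser sigma-algebra, is the conditioning
   variable in [disintegration]. *)
have mid : measurable_fun [set: Omega] (id : Omega -> history_type g k.+1).
  apply: (@history_sub _ _ _ _ g _ _ k.+1 T); last exact: measurable_id.
    exact: sgd_measurable hrun.
  exact: ltnW.
have mg := sgd_measurable hrun kT1.
have -> : (\int[P]_w (stopped k.+1 w)%:E =
    \int[P]_w (EFin \o phi) (w, g k.+1 w))%E.
  by [].
rewrite (disintegration (k := kernel_precomp oracle mx) mid mg); last 3 first.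
- move=> A B mA mB; rewrite (sgd_query hrun)//.
- by apply/measurable_EFinP.
- by move=> z; rewrite lee_fin.
have mstopped : measurable_fun [set: Omega] (fun w => (stopped k w)%:E).
  apply/measurable_EFinP.
  apply: (history_sub (sgd_measurable hrun) (t := k.+1)).
    exact: ltnW.
  exact: measurable_stopped (ltnW kT).
rewrite -ge0_integralZl ?lee_fin ?expR_ge0//; last first.
  by move=> w _; rewrite lee_fin.
apply: ge0_le_integral => //.
- by move=> w _; apply: integral_ge0 => y _; rewrite lee_fin.
- apply: (history_sub (sgd_measurable hrun) (t := k.+1)); first exact: ltnW.
  apply: (measurable_fun_integral_finite_kernel (EFin \o phi)
    (kernel_precomp oracle mx)) => //.
  exact/measurable_EFinP.
- by apply: measurable_funeM.
move=> w _; rewrite /kernel_precomp /phi /=.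
case: (ltP thr (stopped k w)) => [_|sk].
  rewrite integral_cst//= prob_kernel mule1 -EFinM lee_fin ler_peMl//.
  by apply: le_trans (expR_ge1Dx rho); rewrite lerDl rho_ge0.
under eq_integral do rewrite EFinM.
have mexp : measurable_fun setT (fun y => (expR (kappa * inc (x k.+1 w) y))%:E).
  apply/measurable_EFinP; apply: measurableT_comp => //.
  apply: measurable_funM => //.
  exact: (measurable_energy_increment L_gt0 hdiff hsmooth).
rewrite ge0_integralZl ?lee_fin//.
rewrite muleC lee_wpmul2r// ?lee_fin//.
apply: (integral_expR_energy_le L_gt0 hdiff hsmooth hfstar hp sigma_ge0
  lambda_gt0 (ltW eta_gt0) (ltW kappa_gt0) S_ge0 lambda_ge eta_le kappa_eta_le
  kappa_eta2_le (gap_stopped (ltnW kT) sk)) => //.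
- exact: prob_kernel.
- exact: hunbiased.
- exact: hnoise.
Qed.

Lemma integral_stopped_le k : (k <= T)%N ->
  (\int[P]_w (stopped k w)%:E <= (expR (k%:R * rho + kappa * Delta1))%:E)%E.
Proof.
elim: k => [_|k IH kT].
  rewrite /= integral_cst// mul0r add0r [X in (_ * X)%E](_ : _ = 1%E) ?mule1//.
  exact: probability_setT.
apply: (le_trans (integral_stoppedS kT)).
apply: (@le_trans _ _
  ((expR rho)%:E * (expR (k%:R * rho + kappa * Delta1))%:E)%E).
  by rewrite lee_wpmul2l ?lee_fin ?expR_ge0// IH// ltnW.
by rewrite -EFinM -expRD lee_fin ler_expR -natr1; lra.
Qed.

Lemma sgd_tail_bound :
  ((1 - expR (T%:R * rho - kappa * Delta1))%:E <=
   P [set w | eta * \sum_(1 <= t < T.+1) enorm (gradient f (x t w)) ^+ 2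
       <= 4 * Delta1]%R)%E.
Proof.
set target := [set w | _].
have mstopped : measurable_fun [set: Omega] (stopped T).
  apply: (history_sub (sgd_measurable hrun) (t := T.+1)) => //.
  exact: measurable_stopped.
pose bad := [set w | thr < stopped T w].
have mbad : measurable bad.
  have := mstopped measurableT _ (measurable_itv `]thr, +oo[).
  rewrite setTI; congr measurable; apply/seteqP; split=> w /=;
    by rewrite in_itv /= andbT.
have mtarget : measurable target.
  have msum : measurable_fun [set: Omega] (fun w =>
      eta * \sum_(1 <= t < T.+1) enorm (gradient f (x t w)) ^+ 2).
    apply: measurable_funM => //.
    rewrite (_ : (fun w => _) = fun w =>
      \sum_(i < T) enorm (gradient f (x i.+1 w)) ^+ 2); last first.
      by apply/funext => w; rewrite big_add1 big_mkord.
    apply: measurable_sum => i; apply: measurable_funX; apply: measurable_enorm.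
    apply: (measurableT_comp (measurable_gradient L_gt0 hsmooth)).
    apply: (history_sub (sgd_measurable hrun) (t := i.+1)).
      by rewrite ltnS ltnW.
    by apply: measurable_iterate; rewrite /= ltnS ltnW.
  have := msum measurableT _ (measurable_itv `]-oo, 4 * Delta1]).
  by rewrite setTI; congr measurable; apply/seteqP; split=> w /=;
    rewrite in_itv.
(* Off [bad], Q_(T+1) <= 2 Delta1; as f(x_(T+1)) >= fstar, eta/2 times the sum is at most 2
   Delta1. *)
have good_target : ~` bad `<=` target.
  move=> w /negP; rewrite -leNgt => h.
  move: (h); rewrite (stoppedE (leqnn T) h) ler_expR ler_pM2l// /energy.
  rewrite /target /=; have := hfstar (x T.+1 w); lra.
(* Markov's inequality for the stopped process at index [T]. *)
have Pbad : (thr%:E * P bad <= (expR (T%:R * rho + kappa * Delta1))%:E)%E.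
  apply: le_trans (integral_stopped_le (leqnn T)).
  apply: (@le_trans _ _ (\int[P]_(w in bad) (stopped T w)%:E)%E).
    rewrite -integral_cst//; apply: ge0_le_integral => //.
    - by move=> w _; rewrite lee_fin expR_ge0.
    - by apply/measurable_EFinP; exact: measurable_funTS.
    - by move=> w; rewrite lee_fin => /ltW.
  apply: ge0_subset_integral => //.
  - exact/measurable_EFinP.
  - by move=> w _; rewrite lee_fin.
apply: (@le_trans _ _ (P (~` bad))); last first.
  by apply: le_measure => //; rewrite inE//; exact: measurableC.
rewrite probability_setC// EFinB leeB//.
rewrite -lee_pdivlMl ?expR_gt0// in Pbad.
apply: (le_trans Pbad); rewrite -expRN -EFinM -expRD lee_fin ler_expR.
lra.
Qed.

End tail_bound.
(** * The choice of the parameters *)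

(* In the application A = ln (4T/delta), N = T, q = T^((p-1)/(3p-2)),
   l = sqrt L, D = sqrt Delta1 and z = (sigma/lambda)^p. *)
Section parameters.
Context (R : realType) (A q l D lambda eta z N : R).
Hypotheses (A_ge1 : 1 <= A) (q_ge1 : 1 <= q) (l_gt0 : 0 < l) (D_gt0 : 0 < D).
Hypotheses (lambda_gt0 : 0 < lambda) (z_ge0 : 0 <= z) (N_ge0 : 0 <= N).
Hypothesis zN : 32 * z * N <= q ^+ 2.
Hypothesis zlambda : 8 * A * q * z * lambda <= l * D.
Hypothesis lambda_ge : 4 * (l * D) <= lambda.
Hypothesis etaE : eta = D / (8 * A * q * l * lambda).

Let kappa := 2 * A / D ^+ 2.

Let A_gt0 : 0 < A. Proof. exact: lt_le_trans A_ge1. Qed.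
Let q_gt0 : 0 < q. Proof. exact: lt_le_trans q_ge1. Qed.

Let nonzero : (A != 0) * (q != 0) * (l != 0) * (D != 0) * (lambda != 0).
Proof. by rewrite !gt_eqF. Qed.

Let inv_le1 (c : R) : 1 <= c -> c^-1 <= 1.
Proof. by move=> c1; rewrite invf_le1// (lt_le_trans ltr01). Qed.

Lemma eta_small : 4 * l ^+ 2 * eta <= 1.
Proof.
rewrite etaE.
rewrite [leLHS](_ : _ = (4 * (l * D) / lambda) * (8 * (A * q))^-1); last first.
  by field; rewrite !nonzero.
rewrite mulr_ile1 ?divr_ge0 ?invr_ge0 ?mulr_ge0 ?(ltW l_gt0) ?(ltW D_gt0)
  ?(ltW A_gt0) ?(ltW q_gt0) ?(ltW lambda_gt0)//.
  by rewrite ler_pdivrMr// mul1r.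
apply: inv_le1; have := mulr_ege1 A_ge1 q_ge1; lra.
Qed.

Lemma kappa_eta_small : kappa * eta * lambda * (l * D) <= 1 / 4.
Proof.
rewrite etaE /kappa [leLHS](_ : _ = 1 / 4 * q^-1); last first.
  by field; rewrite !nonzero.
have := inv_le1 q_ge1; lra.
Qed.

Lemma kappa_eta2_small :
  kappa * l ^+ 2 * eta ^+ 2 * (3 / 2 * lambda) ^+ 2 <= 1 / 8.
Proof.
rewrite etaE /kappa [leLHS](_ : _ = 9 / 128 * (A * q ^+ 2)^-1); last first.
  by field; rewrite !nonzero.
have /inv_le1 : 1 <= A * q ^+ 2 by rewrite mulr_ege1// exprn_ege1.
lra.
Qed.

(** By [zN], N z / q^2 <= 1/32; by [zlambda] and A >= 1, z lambda / (D q l) <= 1/q^2. The three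
    summands thus contribute at most 1/32, 9/32 and 9/512, in all less than 1 <= A. *)
Lemma total_cost_le : N * step_cost (l ^+ 2) lambda eta kappa (l * D) z <= A.
Proof.
have -> : step_cost (l ^+ 2) lambda eta kappa (l * D) z =
    z * (z * lambda) / (D * q * l) + 9 * z / q ^+ 2
      + 9 / 16 * (z / q ^+ 2) * A^-1.
  by rewrite /step_cost etaE /kappa; field; rewrite !nonzero.
have zNq : N * (z / q ^+ 2) <= 1 / 32.
  by rewrite mulrA ler_pdivrMr ?exprn_gt0//; move: zN; lra.
have h1 : N * (z * (z * lambda) / (D * q * l)) <= 1 / 32.
  apply: le_trans zNq.
  rewrite ler_wpM2l// -mulrA ler_wpM2l// ler_pdivrMr ?mulr_gt0//.
  rewrite [leRHS](_ : _ = (l * D) / q); last by field; rewrite nonzero.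
  rewrite ler_pdivlMr//.
  have : 0 <= A * (q * z * lambda) - q * z * lambda.
    rewrite -{2}(mul1r (q * z * lambda)) -mulrBl mulr_ge0 ?subr_ge0//.
    by rewrite !mulr_ge0 ?(ltW q_gt0) ?(ltW lambda_gt0).
  have : 0 <= q * z * lambda.
    by rewrite !mulr_ge0 ?(ltW q_gt0) ?(ltW lambda_gt0).
  move: zlambda; lra.
have h2 : N * (z / q ^+ 2) * A^-1 <= 1 / 32.
  rewrite -[leRHS]mulr1 ler_pM ?invr_ge0 ?(ltW A_gt0) ?inv_le1//.
  by rewrite mulr_ge0// divr_ge0// sqr_ge0.
move: h1 h2 zNq A_ge1; lra.
Qed.

End parameters.
(** Turns the maximum defining lambda into the minimum in the second formula for eta. *)
Lemma divr_max (R : realType) (u a b : R) : 0 <= u -> 0 < a -> 0 < b ->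
  u / Num.max a b = Num.min (u / a) (u / b).
Proof.
move=> u0 a0 b0; case: (leP a b) => ab.
  by rewrite min_r// ler_wpM2l// lef_pV2.
by rewrite min_l// ler_wpM2l// lef_pV2 ?posrE// ltW.
Qed.

(** * Powers of T and sigma in the clipping level *)

Section powers.
(** In use, [B], [c] and [N] are 8 ln(4T/delta) / sqrt(L Delta1), 4 sqrt(L Delta1) and T. *)
Context (R : realType) (p sigma B c N lambda : R).
Hypotheses (hp : 1 < p) (sigma_gt0 : 0 < sigma) (B_gt0 : 0 < B).
Hypothesis N_ge1 : 1 <= N.
Let e := 3 * p - 2.
Hypothesis lambdaE : lambda =
  Num.max (Num.max
    (B `^ (1 / (p - 1)) * N `^ (1 / e) * sigma `^ (p / (p - 1))) c)
    (32 `^ (1 / p) * sigma * N `^ (1 / e)).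
Let q := N `^ ((p - 1) / e).

Let N_gt0 : 0 < N. Proof. exact: lt_le_trans N_ge1. Qed.
Let e_neq0 : e != 0. Proof. by rewrite gt_eqF// /e; move: hp; lra. Qed.
Let p1_neq0 : p - 1 != 0. Proof. by rewrite gt_eqF// subr_gt0. Qed.
Let p_neq0 : p != 0. Proof. by rewrite gt_eqF// (lt_trans ltr01). Qed.

Lemma clip_level_gt0 : 0 < lambda.
Proof.
by rewrite lambdaE lt_max orbC mulr_gt0 ?powR_gt0// mulr_gt0// powR_gt0.
Qed.

(** The third entry of the maximum, raised to the power p, gives lambda^p >= 32 sigma^p N^(p/e);
    then 1 - p/e = 2(p-1)/e. *)
Lemma noise_ratio_le : 32 * (sigma / lambda) `^ p * N <= q ^+ 2.
Proof.
have h : 32 `^ (1 / p) * sigma * N `^ (1 / e) <= lambda.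
  by rewrite lambdaE le_max lexx orbT.
have {h} : 32 * sigma `^ p * N `^ (p / e) <= lambda `^ p.
  have p0 : 0 <= p by rewrite ltW// (lt_trans ltr01).
  apply: le_trans (ge0_ler_powR p0 _ _ h); rewrite ?nnegrE.
  - rewrite !powRM ?mulr_ge0 ?powR_ge0 ?(ltW sigma_gt0)// -!powRrM.
    by rewrite !mul1r mulVf// powRr1// [e^-1 * p]mulrC.
  - by rewrite !mulr_ge0 ?powR_ge0// ltW.
  - exact/ltW/clip_level_gt0.
have -> : q ^+ 2 = N / N `^ (p / e).
  rewrite -powR_mulrn ?powR_ge0// -powRrM -{2}(powRr1 (ltW N_gt0)).
  rewrite -powRB; last by rewrite (gt_eqF N_gt0) implybT.
  by congr (_ `^ _); rewrite /e; field; exact: e_neq0.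
rewrite powR_div ?(ltW sigma_gt0) ?(ltW clip_level_gt0)// powRN => h.
have lp0 : 0 < lambda `^ p by rewrite powR_gt0// clip_level_gt0.
rewrite ler_pdivlMr ?powR_gt0// [leLHS](_ : _ =
  N * ((32 * sigma `^ p * N `^ (p / e)) / lambda `^ p)); last first.
  by field; rewrite gt_eqF.
by rewrite -[leRHS]mulr1 ler_wpM2l ?(ltW N_gt0)// ler_pdivrMr ?mul1r.
Qed.

(** The first entry, raised to the power p - 1, gives lambda^(p-1) >= B q sigma^p. *)
Lemma bias_ratio_le : B * q * (sigma / lambda) `^ p * lambda <= 1.
Proof.
have h : B `^ (1 / (p - 1)) * N `^ (1 / e) * sigma `^ (p / (p - 1)) <= lambda.
  by rewrite lambdaE !le_max lexx.
have {h} h : B * q * sigma `^ p <= lambda `^ (p - 1).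
  have p10 : 0 <= p - 1 by rewrite subr_ge0 ltW.
  apply: le_trans (ge0_ler_powR p10 _ _ h); rewrite ?nnegrE.
  - rewrite !powRM ?mulr_ge0 ?powR_ge0// -!powRrM !divfK//.
    rewrite powRr1 ?(ltW B_gt0)//.
    by rewrite mul1r [e^-1 * _]mulrC.
  - by rewrite !mulr_ge0 ?powR_ge0.
  - exact/ltW/clip_level_gt0.
have l0 := clip_level_gt0.
rewrite powR_div ?(ltW sigma_gt0) ?(ltW l0)//.
have -> : B * q * (sigma `^ p * lambda `^ (- p)) * lambda =
  (B * q * sigma `^ p) / lambda `^ (p - 1).
  rewrite -powRN opprB addrC powRD ?(gt_eqF l0) ?implybT//.
  by rewrite powRr1 ?(ltW l0)//; ring.
by rewrite ler_pdivrMr ?powR_gt0// mul1r.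
Qed.

End powers.

(** * The two formulas for the step size and the high-probability bound *)

Theorem theorem5 (R : realType) (n : nat) (f : 'rV[R]_n -> R) (L fstar : R)
  (hL : 0 < L)
  (hdiff : forall x, differentiable f x)
  (hsmooth : smooth L f)
  (hfstar : (fstar%:E <= ereal_inf [set (f x)%:E | x in setT])%E)
  (p sigma : R) (hp : 1 < p <= 2) (hsigma : 0 < sigma)
  (oracle : R.-pker 'rV[R]_n ~> 'rV[R]_n)
  (hunbiased : unbiased f oracle)
  (hnoise : bounded_noise f oracle p sigma)
  (T : nat) (hT : (1 <= T)%N)
  (delta : R) (hdelta : 0 < delta < 1)
  (x1 : 'rV[R]_n) (Delta1 : R) (hDelta1 : Delta1 = f x1 - fstar)
  (hDelta1_gt0 : 0 < Delta1)
  (lambda eta : R)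
  (hlambda : lambda =
    Num.max (Num.max
      ((8 * ln (4 * T%:R / delta) / Num.sqrt (L * Delta1)) `^ (1 / (p - 1))
        * T%:R `^ (1 / (3 * p - 2)) * sigma `^ (p / (p - 1)))
      (4 * Num.sqrt (L * Delta1)))
      (32 `^ (1 / p) * sigma * T%:R `^ (1 / (3 * p - 2))))
  (heta : eta =
    Num.sqrt Delta1 * T%:R `^ ((1 - p) / (3 * p - 2))
      / (8 * lambda * Num.sqrt L * ln (4 * T%:R / delta)))
  (disp : measure_display) (Omega : measurableType disp)
  (P : probability Omega R) (x g : nat -> Omega -> 'rV[R]_n)
  (hrun : clipped_sgd P oracle T x1 (fun=> eta) (fun=> lambda) x g) :
  eta =
    Num.sqrt Delta1 / (8 * Num.sqrt L * ln (4 * T%:R / delta))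
      * Num.min (Num.min
          ((8 * ln (4 * T%:R / delta) / Num.sqrt (L * Delta1)) `^ (- 1 / (p - 1))
            * T%:R `^ (- p / (3 * p - 2)) * sigma `^ (- p / (p - 1)))
          (T%:R `^ ((1 - p) / (3 * p - 2)) / (4 * Num.sqrt (L * Delta1))))
          (T%:R `^ (- p / (3 * p - 2)) / (32 `^ (1 / p) * sigma))
  /\
  ((1 - delta)%:E <=
    P [set w | ((1 / T%:R) * \sum_(1 <= t < T.+1) enorm (gradient f (x t w)) ^+ 2
      <= 32 * Num.sqrt (Delta1 * L) * ln (4 * T%:R / delta)
        * Num.max (Num.max
            ((8 * ln (4 * T%:R / delta) / Num.sqrt (L * Delta1))
                `^ (1 / (p - 1))
              * T%:R `^ ((2 - 2 * p) / (3 * p - 2)) * sigma `^ (p / (p - 1)))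
            (4 * Num.sqrt (L * Delta1) * T%:R `^ ((1 - 2 * p) / (3 * p - 2))))
            (32 `^ (1 / p) * sigma * T%:R `^ ((2 - 2 * p) / (3 * p - 2))))%R])%E.
Proof.
have [d0 d1] := andP hdelta; have [p1 p2] := andP hp.
set A := ln _ in heta hlambda *.
set e := 3 * p - 2 in heta hlambda *.
pose N : R := T%:R; rewrite -/N in heta hlambda *.
pose l := Num.sqrt L; pose D := Num.sqrt Delta1.
have l0 : 0 < l by rewrite sqrtr_gt0.
have D0 : 0 < D by rewrite sqrtr_gt0.
have L2 : L = l ^+ 2 by rewrite sqr_sqrtr// ltW.
have D2 : Delta1 = D ^+ 2 by rewrite sqr_sqrtr// ltW.
have SE : Num.sqrt (L * Delta1) = l * D by rewrite sqrtrM// ltW.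
have SE' : Num.sqrt (Delta1 * L) = l * D by rewrite mulrC.
have N1 : 1 <= N by rewrite ler1n.
have N0 : 0 < N by exact: lt_le_trans N1.
have e0 : 0 < e by rewrite /e; lra.
have N4 : 4 <= 4 * N / delta.
  rewrite ler_pdivlMr//; nra.
(* The quadratic bound on the exponential at 1 gives e <= 4 <= 4T/delta. *)
have A1 : 1 <= A.
  rewrite -(@expRK R 1) /A ler_ln ?posrE ?expR_gt0// ?(lt_le_trans _ N4)//.
  apply: le_trans N4; apply: (le_trans (expR_le_quadratic (lexx 1))); lra.
have A0 : 0 < A by exact: lt_le_trans A1.
pose B := 8 * A / (l * D).
have B0 : 0 < B by rewrite divr_gt0 ?mulr_gt0.
rewrite SE SE' -/B -/l -/D in heta hlambda *.
pose q := N `^ ((p - 1) / e).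
have q0 : 0 < q by exact: powR_gt0.
have q1 : 1 <= q.
  by rewrite -[leLHS](powRr0 N) ler_powR// divr_ge0 ?(ltW e0)// subr_ge0 ltW.
have la0 : 0 < lambda by exact: clip_level_gt0 hlambda.
have zN := noise_ratio_le p1 hsigma N1 hlambda.
have zl := bias_ratio_le p1 hsigma B0 N1 hlambda.
rewrite -/e -/q in zN zl.
have qV : N `^ ((1 - p) / e) = q^-1.
  by rewrite -powRN -mulNr opprB.
have etaE : eta = D / (8 * A * q * l * lambda).
  by rewrite heta qV; field; rewrite !gt_eqF.
set z := (sigma / lambda) `^ p in zN zl.
have z0 : 0 <= z by exact: powR_ge0.
have la4 : 4 * (l * D) <= lambda by rewrite hlambda !le_max lexx orbT.
have zl' : 8 * A * q * z * lambda <= l * D.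
  rewrite [leLHS](_ : _ = B * q * z * lambda * (l * D)); last first.
    by rewrite /B; field; rewrite !gt_eqF.
  by rewrite -[leRHS]mul1r ler_wpM2r ?(ltW (mulr_gt0 l0 D0)).
have eta0 : 0 < eta.
  by rewrite etaE divr_gt0// !mulr_gt0.
have powND (u v w : R) : u + v = w -> N `^ u * N `^ v = N `^ w.
  by move=> <-; rewrite powRD// (gt_eqF N0) implybT.
split.
  rewrite heta [LHS](_ : _ =
    D / (8 * l * A) * (N `^ ((1 - p) / e) / lambda)); last first.
    by field; rewrite !gt_eqF.
  have Np : N `^ (- p / e) * N `^ (1 / e) = N `^ ((1 - p) / e).
    by apply: powND; field; rewrite gt_eqF.
  rewrite hlambda !divr_max ?powR_ge0 ?lt_max ?mulr_gt0 ?powR_gt0 ?l0 ?D0//.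
  congr (_ * Num.min (Num.min _ _) _); rewrite -Np.
    by rewrite !mulNr !powRN; field; rewrite !gt_eqF ?powR_gt0.
  by field; rewrite !gt_eqF ?powR_gt0.
pose kappa := 2 * A / D ^+ 2.
have kappa0 : 0 < kappa by rewrite divr_gt0 ?mulr_gt0 ?exprn_gt0.
have hf y : fstar <= f y.
  rewrite -lee_fin; apply: (le_trans hfstar); apply: ereal_inf_lbound.
  by exists y.
have := @sgd_tail_bound R n f L fstar hL hdiff hsmooth hf p sigma lambda eta
  kappa (l * D) hp (ltW hsigma) la0 eta0 kappa0 (ltW (mulr_gt0 l0 D0)) la4.
rewrite {1 2}L2.
move=> /(_ (eta_small A1 q1 l0 D0 la0 la4 etaE)).
move=> /(_ (kappa_eta_small A1 q1 l0 D0 la0 etaE)).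
move=> /(_ (kappa_eta2_small A1 q1 l0 D0 la0 etaE)).
move=> /(_ oracle hunbiased hnoise T x1).
rewrite -hDelta1 L2 D2 -exprMn => /(_ erefl disp Omega P x g hrun).
have cost := total_cost_le A1 q1 l0 D0 la0 z0 (ltW N0) zN zl' etaE.
move=> tail.
(* The exponent is at most A - kappa Delta1 = A - 2A, and exp(-A) = delta/(4T) <= delta. *)
apply: (@le_trans _ _ (1 - expR (T%:R *
  step_cost (l ^+ 2) lambda eta kappa (l * D) z - kappa * D ^+ 2))%:E).
  rewrite lee_fin lerD2l lerN2.
  apply: (@le_trans _ _ (expR (- A))).
    rewrite ler_expR (_ : kappa * D ^+ 2 = 2 * A).
      by move: cost; rewrite -/N; lra.
    by rewrite /kappa divfK// gt_eqF// exprn_gt0.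
  have X0 : 0 < 4 * N / delta by rewrite divr_gt0 ?mulr_gt0.
  rewrite expRN lnK ?posrE// invf_div ler_pdivrMr ?mulr_gt0//.
  by rewrite ler_peMr ?(ltW d0)//; lra.
apply: (le_trans tail).
(* The bound of the statement, multiplied by N, is exactly 4 Delta1 / eta; the two events are
   therefore equal. *)
rewrite le_eqVlt; apply/orP; left; apply/eqP; congr (P _).
have NV : N `^ ((1 - 2 * p) / e) = q / N.
  apply: (mulIf (lt0r_neq0 N0)); rewrite divfK ?gt_eqF//.
  rewrite -{2}(powRr1 (ltW N0)); apply: powND.
  by rewrite /e; field; rewrite gt_eqF.
(* Each entry of this maximum is the corresponding entry for lambda times N^((1-2p)/e). *)
rewrite (_ : Num.max (Num.max _ _) _ = lambda * (q / N)); last first.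
  rewrite -NV hlambda !maxr_pMl ?powR_ge0//.
  have Np : N `^ (1 / e) * N `^ ((1 - 2 * p) / e) = N `^ ((2 - 2 * p) / e).
    by apply: powND; field; rewrite gt_eqF.
  by congr (Num.max (Num.max _ _) _); rewrite -Np; ring.
have WE : 32 * (l * D) * A * (lambda * (q / N)) * N = eta^-1 * (4 * D ^+ 2).
  by rewrite etaE; field; rewrite !gt_eqF.
by apply/seteqP; split => w /=; rewrite mul1r ler_pdivrMl// [N * _]mulrC WE
  ler_pdivlMl.
Qed.
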